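(* Let $N$ be a lattice and let $\Delta$ be a rational polyhedral fan in $N$ that has more than one maximal cone of dimension equal to the rank of $N$. Then there exists a nontrivial multivalued conewise linear integral function on $\Delta$.
   Context: A lattice $N$ is a free abelian group of finite rank; $M=\operatorname{Hom}(N,\mathbb{Z})$ is the dual lattice and $N_{\mathbb{R}}=N\otimes_{\mathbb{Z}}\mathbb{R}$. A fan in $N$ is a finite collection of strongly convex rational polyhedral cones in $N_{\mathbb{R}}$, closed under taking faces, such that any two cones intersect in a common face. An integral linear function on a cone $\sigma$ is the restriction to $\sigma$ of a linear function on $N_{\mathbb{R}}$ given by an element of $M$. A multivalued conewise linear integral function of degree $r$ on $\Delta$ is a collection $\{L_\sigma\}_{\sigma\in\Delta}$, where each $L_\sigma$ is an $r$-element multiset of integral linear functions on $\sigma$ (with the same $r$ for all $\sigma$), such that whenever $\tau$ is a face of $\sigma$, restricting the functions in $L_\sigma$ to $\tau$ gives the multiset $L_\tau$. Such a function is trivial if there exists a multiset $L$ of global linear functions (on $N_{\mathbb{R}}$) such that for every $\sigma\in\Delta$ the multiset $L_\sigma$ is the restriction of $L$ to $\sigma$; otherwise it is nontrivial. *)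

(* Defs.v *)
From HB Require Import structures.
From mathcomp Require Import all_boot all_order all_algebra.
From mathcomp Require Import finmap multiset.
From mathcomp Require Import boolp classical_sets functions cardinality reals.
Set Implicit Arguments.
Unset Strict Implicit.
Unset Printing Implicit Defensive.

Import Order.TTheory GRing.Theory Num.Theory.
Local Open Scope classical_set_scope.
Local Open Scope ring_scope.

Definition lattice_of_rank (N : zmodType) (n : nat) : Prop :=
  exists b : 'I_n -> N, forall x : N,
    exists! a : {ffun 'I_n -> int}, x = \sum_(i < n) b i *~ a i.

(* The universal property of N -> N (x)_Z R, x |-> x (x) 1: every additive map
   from N to a real vector space factors uniquely through iota as a linear
   map. *)
Definition is_realification (R : realType) (N : zmodType) (V : vectType R)
    (iota : {additive N -> V}) : Prop :=
  forall (W : lmodType R) (f : {additive N -> W}),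
    exists F : {linear V -> W},
      (forall x, F (iota x) = f x) /\
      (forall G : {linear V -> W}, (forall x, G (iota x) = f x) -> G =1 F).

Section Cones.
Variables (R : realType) (N : zmodType) (V : vectType R).
Variable iota : {additive N -> V}.
Implicit Types (sigma tau : set V) (Delta : set (set V)).

Definition rational_polyhedral_cone sigma : Prop :=
  exists (k : nat) (g : 'I_k -> N),
    sigma = [set v | exists c : 'I_k -> R,
      (forall i, 0 <= c i) /\ v = \sum_(i < k) c i *: iota (g i)].

Definition strongly_convex sigma : Prop :=
  forall v, sigma v -> sigma (- v) -> v = 0.

Definition is_face tau sigma : Prop :=
  exists u : {scalar V},
    (forall v, sigma v -> 0 <= u v) /\ tau = sigma `&` [set v | u v = 0].

Definition has_dim sigma (d : nat) : Prop :=
  exists U : {vspace V},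
    [/\ forall v, sigma v -> v \in U,
        forall U' : {vspace V},
          (forall v, sigma v -> v \in U') -> (U <= U')%VS
      & \dim U = d].

Definition is_fan Delta : Prop :=
  [/\ finite_set Delta,
      forall sigma, Delta sigma ->
        rational_polyhedral_cone sigma /\ strongly_convex sigma,
      forall sigma tau, Delta sigma -> is_face tau sigma -> Delta tau
    & forall sigma sigma', Delta sigma -> Delta sigma' ->
        is_face (sigma `&` sigma') sigma /\ is_face (sigma `&` sigma') sigma'].

Definition is_maximal_cone Delta sigma : Prop :=
  Delta sigma /\ forall tau, Delta tau -> sigma `<=` tau -> tau = sigma.

(* Functions on sigma are encoded as functions V -> R vanishing outside sigma,
   so that restricting to a subset is again an operation on V -> R. *)
Definition restr sigma (f : V -> R) : V -> R := patch (fun=> 0) sigma f.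

Definition integral_linear_on sigma (f : V -> R) : Prop :=
  exists (m : {additive N -> int}) (l : {scalar V}),
    (forall x, l (iota x) = (m x)%:~R) /\ f = restr sigma l.

Definition mset_restr sigma (A : {mset (V -> R)}%mset) : {mset (V -> R)}%mset :=
  seq_mset [seq restr sigma f | f <- A].

(* L is only meaningful on the members of Delta. *)
Definition multivalued_conewise_linear_integral Delta (r : nat)
    (L : set V -> {mset (V -> R)}%mset) : Prop :=
  (forall sigma, Delta sigma ->
     size (L sigma) = r /\
     forall f, f \in L sigma -> integral_linear_on sigma f) /\
  (forall sigma tau, Delta sigma -> Delta tau -> is_face tau sigma ->
     mset_restr tau (L sigma) = L tau).

Definition trivial_multivalued Delta (L : set V -> {mset (V -> R)}%mset) : Prop :=
  exists A : {mset (V -> R)}%mset,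
    (forall f, f \in A -> exists l : {scalar V}, f = l) /\
    (forall sigma, Delta sigma -> L sigma = mset_restr sigma A).

End Cones.

(* Main.v *)
Require Import Defs.
From HB Require Import structures.
From mathcomp Require Import all_boot all_order all_algebra.
From mathcomp Require Import finmap multiset.
From mathcomp Require Import boolp classical_sets functions cardinality reals.
Import Order.TTheory GRing.Theory Num.Theory.
Local Open Scope classical_set_scope.
Local Open Scope ring_scope.

(** Fix a maximal cone s0 of full dimension, and suppose that A and B are two
    finite multisets of global integral linear functions such that A and B have
    the same restriction to every proper face of s0, while 0 belongs to A and
    not to B.  Put B on s0 and A on every other cone.  The pieces agree on
    faces: by maximality s0 is a face of no other cone, and its own proper
    faces do not distinguish A from B.  The result is nontrivial.  Indeed, let C
    be a multiset of global linear functions inducing it, and let s1 be another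
    cone of full dimension.  Some f in C vanishes on s1, because 0 is in A; as
    s1 spans the space, f = 0; so the restriction of 0 to s0 is that of some
    member of B, and as s0 spans the space too, this member is 0.

    It remains to find A and B ([separating_lists]).  Every proper face tau of
    s0 lies in the kernel of a nonzero integral linear function u_tau
    ([integral_functional_on_face]): the real functional that cuts out tau solves
    a homogeneous linear system with integer coefficients, and such a system
    with a nonzero real solution has a nonzero integral one
    ([int_left_kernel]).  In the group ring of the dual lattice M consider the
    product over all tau of (1 - x^(k_tau u_tau)), where the k_tau are natural
    numbers, and let A and B collect the exponents of the positive and of the
    negative terms of its expansion: the sums of the k_tau u_tau over the subsets of the set of
    proper faces, of even and of odd size respectively.  The factor of tau
    vanishes on restriction to tau, hence A and B agree there.  The empty sum
    puts 0 in A, and 0 stays out of B for a suitable choice of the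
    multipliers k_tau, made one at a time. *)

(** * Linear maps given by functions *)

Lemma additive_of {M P : zmodType} (f : M -> P) :
  {morph f : x y / x + y} -> exists g : {additive M -> P}, g =1 f.
Proof.
move=> fD.
have f0 : f 0 = 0 by apply: (addrI (f 0)); rewrite -fD !addr0.
pose S := GRing.isNmodMorphism.Build M P f (conj f0 fD).
by exists (HB.pack_for {additive M -> P} f S).
Qed.

Lemma scalar_of {R : realType} {V : vectType R} (f : V -> R) :
  (forall (a : R) v w, f (a *: v + w) = a * f v + f w) ->
  exists l : {scalar V}, l =1 f.
Proof.
move=> fL.
pose S := GRing.isLinear.Build R V R *%R f fL.
by exists (HB.pack_for {scalar V} f S).
Qed.

Lemma scalar_ker {R : realType} {V : vectType R} (u : {scalar V}) :
  exists U : {vspace V}, forall v, (v \in U) = (u v == 0).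
Proof.
have uL : linear (u : V -> R^o) by move=> a v w; rewrite linearP.
pose S := GRing.isLinear.Build R V R^o *:%R (u : V -> R^o) uL.
pose u' := HB.pack_for {linear V -> R^o} (u : V -> R^o) S.
by exists (lker (linfun u')) => v; rewrite memv_ker lfunE.
Qed.

(** * Lattices and integer linear systems *)

Lemma lattice_coord {N : zmodType} {n : nat} (hN : lattice_of_rank N n) :
  exists (b : 'I_n -> N) (crd : {additive N -> 'rV[int]_n}),
    (forall x, x = \sum_i b i *~ crd x 0 i) /\
    (forall i, crd (b i) = delta_mx 0 i).
Proof.
have [b hb] := hN.
have [c hc] := choice hb.
have cE x : x = \sum_i b i *~ c x i by have [] := hc x.
have cU x (a : 'I_n -> int) : x = \sum_i b i *~ a i -> c x = finfun a.
  move=> xE; have [_] := hc x; apply; rewrite {1}xE.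
  by apply: eq_bigr => i _; rewrite ffunE.
have cD : {morph (fun x => \row_i c x i) : x y / x + y}.
  move=> x y; apply/rowP=> i; rewrite !mxE (cU _ (fun i => c x i + c y i)) ?ffunE//.
  rewrite {1}[x]cE {1}[y]cE -big_split.
  by apply: eq_bigr => j _; rewrite mulrzDr.
have [crd crdE] := additive_of _ cD.
exists b, crd; split=> [x|i].
  by rewrite {1}[x]cE; apply: eq_bigr => i _; rewrite crdE mxE.
rewrite crdE; apply/rowP=> j.
rewrite !mxE (cU _ (fun j => (j == i)%:Z)) ?ffunE //=; first by case: eqP.
rewrite (bigD1 i) //= eqxx mulr1z big1 ?addr0 // => k /negPf ->.
by rewrite mulr0z.
Qed.

(** The rank of an integer matrix is the same over the rationals and over the
    reals, so a real kernel vector forces a rational one; clearing denominators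
    makes it integral. *)
Lemma int_left_kernel {R : realType} {n k : nat} (G : 'M[int]_(n, k)) (w : 'rV[R]_n) :
  w != 0 -> w *m map_mx intr G = 0 -> exists2 a : 'rV[int]_n, a != 0 & a *m G = 0.
Proof.
move=> w0 wG.
pose GQ : 'M[rat]_(n, k) := map_mx intr G.
have GR : map_mx intr G = map_mx (ratr : rat -> R) GQ.
  by rewrite -map_mx_comp; apply/matrixP=> i j; rewrite !mxE /= ratr_int.
have : ~~ row_free GQ.
  apply/negP => /row_freeP[B GB]; case/eqP: w0.
  rewrite -[w]mulmx1 -(map_mx1 (ratr : {rmorphism rat -> R})) -GB map_mxM -GR.
  by rewrite mulmxA wG mul0mx.
rewrite -kermx_eq0 => /rowV0Pn[r /sub_kermxP rG r0].
(* A common denominator of the entries of r comes from the polynomial having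
   these entries as coefficients. *)
have [q [d d0 qE]] := rat_poly_scale (rVpoly r).
have rE : r = d%:~R^-1 *: map_mx intr (poly_rV q : 'rV[int]_n).
  apply/rowP=> j; rewrite !mxE -[r in LHS]rVpolyK mxE qE coefZ coef_map //.
have dQ : d%:~R^-1 != 0 :> rat by rewrite invr_eq0 intr_eq0.
exists (poly_rV q).
  by apply: contraNneq r0 => q0; rewrite rE q0 map_mx0 scaler0.
suff: map_mx (intr : int -> rat) (poly_rV q *m G) = 0.
  move/matrixP=> qG; apply/matrixP=> i j; apply/eqP.
  by have /eqP := qG i j; rewrite !mxE intr_eq0.
rewrite map_mxM; apply: (scalerI dQ).
by rewrite scalemxAl -rE rG scaler0.
Qed.

(** * Linear functions on the realification of a lattice *)

Section Realification.
Context {R : realType} {N : zmodType} {V : vectType R} (iota : {additive N -> V}).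
Context (hV : is_realification iota).

Lemma realification_extends (m : {additive N -> int}) :
  exists l : {scalar V}, forall x, l (iota x) = (m x)%:~R.
Proof.
have mD : {morph (fun x => (m x)%:~R : R^o) : x y / x + y}.
  by move=> x y; rewrite raddfD intrD.
have [f fE] := additive_of _ mD.
have [F [FE _]] := hV _ f.
have [|l lE] := scalar_of (F : V -> R); first by move=> a v w; rewrite linearP.
by exists l => x; rewrite lE FE fE.
Qed.

(** The identity and the projection onto U both extend iota to a linear
    endomorphism of V, so they coincide. *)
Lemma realification_span (U : {vspace V}) :
  (forall x, iota x \in U) -> U = fullv.
Proof.
move=> iU; have [F [_ FU]] := hV _ iota.
have idF : idfun =1 F by apply: FU.
have prF : projv U =1 F by apply: (FU (projv U)) => x; rewrite /= projv_id.
apply/vspaceP=> v; rewrite memvf.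
by rewrite [v](_ : _ = projv U v) ?memv_proj // prF -idF.
Qed.

Lemma realification_eq0 (u : {scalar V}) :
  (forall x, u (iota x) = 0) -> forall v, u v = 0.
Proof.
move=> u0 v; have [U UE] := scalar_ker u.
apply/eqP; rewrite -UE (realification_span U) ?memvf // => x.
by rewrite UE u0.
Qed.

Lemma realification_dim {n : nat} : lattice_of_rank N n -> (\dim {:V} <= n)%N.
Proof.
move=> /lattice_coord[b [crd [bE _]]].
rewrite -(realification_span <<[seq iota (b i) | i <- enum 'I_n]>>%VS).
  by apply: leq_trans (dim_span _) _; rewrite size_map -cardE card_ord.
move=> x; rewrite (bE x) raddf_sum; apply: memv_suml => i _.
rewrite raddfMz -scaler_int; apply: memvZ.
by apply: memv_span; apply: map_f; rewrite mem_enum.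
Qed.

(** The span of sigma has dimension n >= dim V, so it is V. *)
Lemma full_dim_separates {n : nat} (sigma : set V) (l : {scalar V}) :
  lattice_of_rank N n -> has_dim sigma n ->
  (forall v, sigma v -> l v = 0) -> forall v, l v = 0.
Proof.
move=> hN [U [_ Umin dimU]] l0 v.
have [K KE] := scalar_ker l.
have UK : (U <= K)%VS by apply: Umin => w /l0 lw; rewrite KE lw.
have UT : U = fullv.
  by apply/eqP; rewrite eqEdim subvf dimU realification_dim.
by apply/eqP; rewrite -KE; apply: (subvP UK); rewrite UT memvf.
Qed.

(** The hyperplane u = 0 may be irrational.  The face that it cuts out of sigma is
    generated by those generators of sigma on which u vanishes, so f only needs
    to vanish on these: this is an integer linear system in the coordinates of
    f, and the values of u on a basis of N are a nonzero real solution of it. *)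
Lemma integral_functional_on_face {n : nat} (sigma : set V) (u : {scalar V}) :
  lattice_of_rank N n -> rational_polyhedral_cone iota sigma ->
  (forall v, sigma v -> 0 <= u v) -> ~ (forall v, u v = 0) ->
  exists f : V -> R, [/\ integral_linear_on iota setT f, f != 0 &
    forall v, sigma v -> u v = 0 -> f v = 0].
Proof.
move=> /lattice_coord[b [crd [bE crdb]]] [k [g sE]] u_ge0 u_neq0.
(* The columns of the other generators are set to 0, so they impose nothing. *)
pose G : 'M[int]_(n, k) :=
  \matrix_(i, j) if u (iota (g j)) == 0 then crd (g j) 0 i else 0.
pose w : 'rV[R]_n := \row_i u (iota (b i)).
have uE x : u (iota x) = \sum_i w 0 i * (crd x 0 i)%:~R.
  rewrite {1}(bE x) !raddf_sum; apply: eq_bigr => i _.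
  by rewrite !raddfMz mxE -mulrzr.
have w0 : w != 0.
  apply: contra_notN u_neq0 => /eqP w0; apply: realification_eq0 => x.
  by rewrite uE big1 // => i _; rewrite w0 mxE mul0r.
have wG : w *m map_mx intr G = 0.
  apply/rowP=> j; rewrite [RHS]mxE mxE.
  have [ugj|ugj] := eqVneq (u (iota (g j))) 0.
    rewrite -[RHS]ugj uE; apply: eq_bigr => i _.
    by rewrite !mxE ugj eqxx.
  by rewrite big1 // => i _; rewrite !mxE (negPf ugj) mulr0.
have [a a0 aG] := int_left_kernel _ _ w0 wG.
have mD : {morph (fun x => \sum_i a 0 i * crd x 0 i) : x y / x + y}.
  move=> x y; rewrite -big_split; apply: eq_bigr => i _.
  by rewrite raddfD mxE mulrDr.
have [m mE] := additive_of _ mD.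
have [l lE] := realification_extends m.
exists l; split; first by exists m, l; split; rewrite // /restr patch_setT.
  apply: contra_neq a0 => l0; apply/rowP=> i; rewrite mxE.
  have := lE (b i); rewrite l0 mE crdb (bigD1 i) //= !mxE !eqxx mulr1.
  rewrite big1 => [/esym/eqP|j /negPf ji]; last by rewrite !mxE eqxx ji mulr0.
  by rewrite addr0 intr_eq0 => /eqP.
move=> v; rewrite {1}sE => -[c [c0 ->]]; rewrite !linear_sum => /eqP.
have sg j : sigma (iota (g j)).
  rewrite sE; exists (fun i => (i == j)%:R); split=> [i|]; first exact: ler0n.
  rewrite (bigD1 j) //= eqxx scale1r big1 ?addr0 // => i /negPf ->.
  by rewrite scale0r.
(* All terms c_i u(g_i) are nonnegative and their sum is 0. *)
rewrite psumr_eq0 => [/allP cu0|i _]; last first.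
  by rewrite linearZ mulr_ge0 ?u_ge0.
rewrite big1 // => j _; rewrite linearZ /=.
have := cu0 j (mem_index_enum j); rewrite linearZ mulf_eq0 => /orP[/eqP->|ug0].
  by rewrite mul0r.
suff -> : l (iota (g j)) = 0 by rewrite mulr0.
have /rowP/(_ j) := aG; rewrite !mxE => aGj.
rewrite lE mE; apply: (etrans _ (congr1 intr aGj)); congr (_%:~R).
by apply: eq_bigr => i _; rewrite mxE ug0.
Qed.

End Realification.

(** * Restricting multisets of functions *)

Section Restriction.
Context {R : realType} {N : zmodType} {V : vectType R} (iota : {additive N -> V}).

Lemma restr_sub (tau sigma : set V) (f : V -> R) :
  tau `<=` sigma -> restr tau (restr sigma f) = restr tau f.
Proof.
by move=> ts; rewrite /restr -patch_setI; congr patch; apply: setIidl.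
Qed.

Lemma restr_eqP (sigma : set V) (f g : V -> R) :
  restr sigma f = restr sigma g <-> forall v, sigma v -> f v = g v.
Proof.
rewrite -eq_restrictP; split=> fg v; first by move=> sv; apply: fg; rewrite inE.
by rewrite inE; apply: fg.
Qed.

Lemma integral_linear_restr (sigma : set V) (f : V -> R) :
  integral_linear_on iota setT f -> integral_linear_on iota sigma (restr sigma f).
Proof.
by move=> [m [l [lE ->]]]; exists m, l; rewrite /restr patch_setT.
Qed.

Lemma integral_linear_global (f : V -> R) :
  integral_linear_on iota setT f -> exists l : {scalar V}, f = l.
Proof. by move=> [m [l [_ ->]]]; exists l; rewrite /restr patch_setT. Qed.

Lemma integral_linear0 : integral_linear_on iota setT (0 : V -> R).
Proof.
by exists \0, \0; rewrite /restr patch_setT.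
Qed.

Lemma integral_linearD (f g : V -> R) : integral_linear_on iota setT f ->
  integral_linear_on iota setT g -> integral_linear_on iota setT (f + g).
Proof.
move=> [m [l [lE ->]]] [m' [l' [lE' ->]]]; rewrite /restr !patch_setT.
exists (m \+ m'), (l \+ l'); rewrite /restr patch_setT; split=> // x.
by rewrite /= lE lE' intrD.
Qed.

Lemma integral_linearMn (f : V -> R) (k : nat) :
  integral_linear_on iota setT f -> integral_linear_on iota setT (f *+ k).
Proof.
move=> fI; elim: k => [|k IH]; first exact: integral_linear0.
by rewrite mulrS; apply: integral_linearD.
Qed.

Lemma mset_restr_seq (sigma : set V) (s : seq (V -> R)) :
  mset_restr sigma (seq_mset s) = seq_mset (map (restr sigma) s).
Proof.
by apply/eq_seq_msetP; apply: perm_map; apply: perm_eq_seq_mset.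
Qed.

Lemma mset_restr_sub (tau sigma : set V) (A : {mset (V -> R)}%mset) :
  tau `<=` sigma -> mset_restr tau (mset_restr sigma A) = mset_restr tau A.
Proof.
move=> ts; rewrite [X in mset_restr _ X]/mset_restr mset_restr_seq -map_comp.
by congr seq_mset; apply: eq_map => f /=; rewrite restr_sub.
Qed.

Lemma mem_mset_restr (sigma : set V) (A : {mset (V -> R)}%mset) (f : V -> R) :
  f \in mset_restr sigma A <-> exists2 g, g \in A & f = restr sigma g.
Proof.
by rewrite (perm_mem (perm_eq_seq_mset _)); split=> [/mapP|gA]; last exact/mapP.
Qed.

Lemma size_mset_restr (sigma : set V) (A : {mset (V -> R)}%mset) :
  size (mset_restr sigma A) = size A.
Proof. by rewrite (perm_size (perm_eq_seq_mset _)) size_map. Qed.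

(** * Two lists that agree on prescribed sets *)

Lemma exists_natmul_notin (u : V -> R) (s : seq (V -> R)) :
  u != 0 -> exists k, - (u *+ k) \notin s.
Proof.
move=> u0; apply: contrapT => ks.
have [v uv] : exists v, u v != 0.
  apply: contrapT => uv; case/eqP: u0; apply/funext => v.
  by apply/eqP; apply: contrapT => /negP uv0; apply: uv; exists v.
pose t := mkseq (fun k => - (u *+ k)) (size s).+1.
have: (size t <= size s)%N; last by rewrite size_mkseq ltnn.
apply: uniq_leq_size => [|_ /mapP[k _ ->]].
  apply: mkseq_uniq => i j /oppr_inj /(congr1 (fun f : V -> R => f v)).
  rewrite !natmulfctE -[LHS]mulr_natr -[RHS]mulr_natr => uij.
  by have /eqP := mulfI uv uij; rewrite eqr_nat => /eqP.
by apply: contrapT => /negP uk; apply: ks; exists k.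
Qed.

(** Multiplying the formal difference A - B by 1 - x^(k u) turns the pair (A, B)
    into (A + (B shifted by k u), B + (A shifted by k u)).  On a set where u
    vanishes the shift is invisible, so the two lists become equal there;
    where A and B already agreed, they still do.  The new B contains 0 only if
    A contains - k u, and some k avoids that. *)
Lemma separating_lists (taus : seq (set V)) :
  (forall tau, tau \in taus -> exists u : V -> R,
     [/\ integral_linear_on iota setT u, u != 0 & forall v, tau v -> u v = 0]) ->
  exists A B : seq (V -> R),
    [/\ forall f, f \in A ++ B -> integral_linear_on iota setT f,
        0 \in A, 0 \notin B &
        forall tau, tau \in taus ->
          perm_eq (map (restr tau) A) (map (restr tau) B)].
Proof.
elim: taus => [_|tau taus IH tausP].
  exists [:: 0], [::]; split=> // [f|]; last exact: mem_head.
  by rewrite inE => /eqP ->; apply: integral_linear0.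
have [|A [B [ABI A0 B0 AB]]] := IH.
  by move=> t tt; apply: tausP; rewrite inE tt orbT.
have [|u [uI u0 utau]] := tausP tau; first by rewrite inE eqxx.
have [k kA] := exists_natmul_notin u A u0.
pose sh := map (fun f => f + u *+ k).
exists (A ++ sh B), (B ++ sh A); split.
- have shI s f : {subset s <= A ++ B} -> f \in sh s -> integral_linear_on iota setT f.
    move=> sAB /mapP[g /sAB gAB ->]; apply: integral_linearD; first exact: ABI.
    exact: integral_linearMn.
  move=> f; rewrite !mem_cat -!orbA => /or4P[fA|fB|fB|fA].
  + by apply: ABI; rewrite mem_cat fA.
  + by apply: (shI _ _ _ fB) => g gB; rewrite mem_cat gB orbT.
  + by apply: ABI; rewrite mem_cat fB orbT.
  + by apply: (shI _ _ _ fA) => g gA; rewrite mem_cat gA.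
- by rewrite mem_cat A0.
- rewrite mem_cat negb_or B0; apply: contraNN kA => /mapP[g gA /esym/eqP].
  by rewrite addr_eq0 => /eqP <-.
move=> t; rewrite inE !map_cat => /orP[/eqP ->|tt].
  have shE s : map (restr tau) (sh s) = map (restr tau) s.
    rewrite -map_comp; apply: eq_map => f /=; apply/restr_eqP => v tv.
    by rewrite addrfctE natmulfctE utau // mul0rn addr0.
  by rewrite !shE perm_catC.
have shE s : map (restr t) (sh s) = map (fun f => f + restr t (u *+ k)) (map (restr t) s).
  rewrite -!map_comp; apply: eq_map => f /=; apply/funext => v.
  by rewrite /restr !addrfctE /patch; case: ifP => //; rewrite addr0.
apply: perm_cat; first exact: AB.
by rewrite !shE; apply: perm_map; rewrite perm_sym; apply: AB.
Qed.

End Restriction.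

(** * The multivalued function *)

Theorem theorem2p1 (R : realType) (N : zmodType) (n : nat)
    (hN : lattice_of_rank N n)
    (V : vectType R) (iota : {additive N -> V}) (hV : is_realification iota)
    (Delta : set (set V)) (hDelta : is_fan iota Delta)
    (hmax : exists sigma sigma' : set V,
        [/\ sigma <> sigma',
            is_maximal_cone Delta sigma /\ has_dim sigma n
          & is_maximal_cone Delta sigma' /\ has_dim sigma' n]) :
  exists (r : nat) (L : set V -> {mset (V -> R)}%mset),
    multivalued_conewise_linear_integral iota Delta r L /\
    ~ trivial_multivalued Delta L.
Proof.
have [s0 [s1 [s01 [[Ds0 max0] dim0] [[Ds1 _] dim1]]]] := hmax.
have [finD coneD faceD capD] := hDelta.
have [D DE] := (finite_seqP _).1 finD.
have DP s : Delta s -> s \in D by rewrite DE.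
pose faces := [seq tau <- D | `[< is_face tau s0 >] & tau != s0].
have facesP tau : tau \in faces -> is_face tau s0 /\ tau <> s0.
  by rewrite mem_filter => /andP[/andP[/asboolP ? /eqP ?] _].
have facesI tau : Delta tau -> is_face tau s0 -> tau <> s0 -> tau \in faces.
  move=> Dt ft ts; rewrite mem_filter DP // andbT; apply/andP.
  by split; [apply/asboolP|apply/eqP].
have face_sub tau s : is_face tau s -> tau `<=` s.
  by move=> [u [_ ->]] v [].
have [|A [B [ABI A0 B0 AB]]] := separating_lists iota faces.
  move=> tau /facesP[[u [u_ge0 tauE]] tau_neq].
  have [|f [fI f0 fu]] := integral_functional_on_face iota hV s0 u hN (coneD _ Ds0).1 u_ge0.
    by move=> u0; apply: tau_neq; rewrite tauE; apply: setIidl => v _; apply: u0.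
  by exists f; split=> // v; rewrite tauE => -[]; apply: fu.
have AI f : f \in A -> integral_linear_on iota setT f.
  by move=> fA; apply: ABI; rewrite mem_cat fA.
have BI f : f \in B -> integral_linear_on iota setT f.
  by move=> fB; apply: ABI; rewrite mem_cat fB orbT.
(* The face s0 `&` s1 is proper, hence A and B have equal restrictions to at
   least one cone; comparing them there gives equal lengths. *)
have sizeAB : size A = size B.
  have [cap0 _] := capD _ _ Ds0 Ds1.
  have /AB/perm_size : s0 `&` s1 \in faces; last by rewrite !size_map.
  apply: facesI => // [|cap]; first exact: faceD cap0.
  by apply: s01; apply/esym/max0 => // v; rewrite -{1}cap => -[].
pose L s := mset_restr s (seq_mset (if s == s0 then B else A)).
exists (size A), L; split; first split.
- move=> s Ds; split.
    by rewrite size_mset_restr (perm_size (perm_eq_seq_mset _)); case: ifP.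
  move=> f /mem_mset_restr[g]; rewrite (perm_mem (perm_eq_seq_mset _)) => gAB ->.
  by apply: integral_linear_restr; move: gAB; case: ifP => _; [apply: BI|apply: AI].
- move=> s tau Ds Dtau ft; rewrite /L mset_restr_sub; last exact: face_sub.
  have [ss0|/eqP ss0] := eqVneq s s0; have [ts0|/eqP ts0] := eqVneq tau s0 => //.
    rewrite !mset_restr_seq; apply/eq_seq_msetP; rewrite perm_sym; apply: AB.
    by apply: facesI => //; rewrite -ss0.
  by case: ss0; apply: max0 => //; rewrite -ts0; apply: face_sub.
- move=> [C [C_lin LC]].
  have /mem_mset_restr[f fC f1] : restr s1 (0 : V -> R) \in mset_restr s1 C.
    rewrite -LC // /L; have /nesym/eqP/negPf -> := s01.
    apply/mem_mset_restr; exists 0; last by [].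
    by rewrite (perm_mem (perm_eq_seq_mset _)).
  have [l fl] := C_lin f fC.
  have f0 : f = 0.
    apply/funext=> v; rewrite fl; apply: (full_dim_separates iota hV s1 l hN dim1).
    by move=> w s1w; rewrite -fl; have /restr_eqP/(_ w s1w) := f1.
  have /mem_mset_restr[g] : restr s0 f \in L s0.
    by rewrite LC //; apply/mem_mset_restr; exists f.
  rewrite eqxx (perm_mem (perm_eq_seq_mset _)) => gB.
  rewrite f0 => /restr_eqP g0; case/negP: B0.
  suff -> : 0 = g by [].
  have [l' gl'] := integral_linear_global iota _ (BI g gB).
  apply/funext => v; rewrite gl'.
  apply/esym/(full_dim_separates iota hV s0 l' hN dim0) => w s0w.
  by rewrite -gl' -g0.
Qed.
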